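(* Let $N\ge 7$ be an integer, $h>0$, and let $T_{\epsilon,\sigma}$ be the $N\times N$ matrix defined in the context. If $\epsilon=0$ and $\sigma=1$, then $T_{\epsilon,\sigma}$ is an $M$-matrix.
   Context: The matrix $T_{\epsilon,\sigma}$ is the stiffness matrix of the cell centered Galerkin (CCG) discretization, with barycentric trace reconstruction, of $-u''=f$ on an interval with homogeneous Dirichlet conditions, on a uniform mesh of $N$ cells of size $h$. Explicitly, with real parameters $\epsilon$ and $\sigma$, put $$a=\tfrac{5\sigma}{4}-\tfrac{\epsilon}{4}+\tfrac34,\quad b=\tfrac{\epsilon}{16}-\tfrac{15\sigma}{16}-\tfrac1{16},\quad c=\tfrac{\epsilon}{8}+\tfrac{3\sigma}{8}-\tfrac38,\quad d=\tfrac1{16}-\tfrac{\sigma}{16}-\tfrac{\epsilon}{16},$$ $$a_1=\tfrac{5\sigma}{4}-\tfrac{3\epsilon}{16}+\tfrac{11}{16},\quad a_0=\tfrac{13\sigma}{8}-\tfrac{5\epsilon}{16}+\tfrac{13}{16},\quad b_0=\tfrac5{16}-\tfrac{9\sigma}{8}-\tfrac{\epsilon}{16},\quad c_0=\tfrac{3\epsilon}{16}+\tfrac{7\sigma}{16}-\tfrac7{16}.$$ Then $T_{\epsilon,\sigma}=\frac1h M$, where $M$ is the $N\times N$ matrix with entries (indices $1\le i,j\le N$): - $M_{ii}=a_0$ if $i\in\{1,N\}$, $M_{ii}=a_1$ if $i\in\{2,N-1\}$, and $M_{ii}=a$ otherwise; - if $|i-j|=1$: $M_{ij}=b_0$ when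 $\{i,j\}=\{1,2\}$ or $\{i,j\}=\{N-1,N\}$, and $M_{ij}=b$ otherwise; - if $|i-j|=2$: $M_{ij}=c_0$ when $\{i,j\}=\{1,3\}$ or $\{i,j\}=\{N-2,N\}$, and $M_{ij}=c$ otherwise; - if $|i-j|=3$: $M_{ij}=d$; - if $|i-j|\ge4$: $M_{ij}=0$. A $Z$-matrix is a real square matrix with nonpositive off-diagonal entries; a (nonsingular) $M$-matrix is a $Z$-matrix that is nonsingular with entrywise nonnegative inverse. *)

(* Defs.v *)
From mathcomp Require Import all_boot all_order all_algebra.
From mathcomp Require Import reals.
Set Implicit Arguments.
Unset Strict Implicit.
Unset Printing Implicit Defensive.
Import Order.TTheory GRing.Theory Num.Theory.
Local Open Scope ring_scope.

Definition Z_matrix (R : realType) (n : nat) (A : 'M[R]_n) : Prop :=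
  forall i j : 'I_n, i != j -> A i j <= 0.

Definition M_matrix (R : realType) (n : nat) (A : 'M[R]_n) : Prop :=
  [/\ Z_matrix A, A \in unitmx & forall i j : 'I_n, 0 <= invmx A i j].

Section CCG.
Variables (R : realType) (eps sigma : R).

Definition ccg_a : R := 5 * sigma / 4 - eps / 4 + 3 / 4.
Definition ccg_b : R := eps / 16 - 15 * sigma / 16 - 1 / 16.
Definition ccg_c : R := eps / 8 + 3 * sigma / 8 - 3 / 8.
Definition ccg_d : R := 1 / 16 - sigma / 16 - eps / 16.
Definition ccg_a1 : R := 5 * sigma / 4 - 3 * eps / 16 + 11 / 16.
Definition ccg_a0 : R := 13 * sigma / 8 - 5 * eps / 16 + 13 / 16.
Definition ccg_b0 : R := 5 / 16 - 9 * sigma / 8 - eps / 16.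
Definition ccg_c0 : R := 3 * eps / 16 + 7 * sigma / 16 - 7 / 16.

Definition same_pair (i j k l : nat) : bool :=
  ((i == k) && (j == l)) || ((i == l) && (j == k)).

(* The entry M_ij for 1-based indices 1 <= i, j <= N. *)
Definition ccg_entry (N i j : nat) : R :=
  match `|i - j|%N with
  | 0 => if (i == 1%N) || (i == N) then ccg_a0
         else if (i == 2%N) || (i == N.-1) then ccg_a1
         else ccg_a
  | 1 => if same_pair i j 1 2 || same_pair i j N.-1 N then ccg_b0 else ccg_b
  | 2 => if same_pair i j 1 3 || same_pair i j N.-2 N then ccg_c0 else ccg_c
  | 3 => ccg_d
  | _ => 0
  end.

(* Elements of 'I_N are 0-based, hence the shift. *)
Definition ccg_M (N : nat) : 'M[R]_N :=
  \matrix_(i < N, j < N) ccg_entry N i.+1 j.+1.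

Definition ccg_T (N : nat) (h : R) : 'M[R]_N := h^-1 *: ccg_M N.

End CCG.

(* Main.v *)
Require Import Defs.
From mathcomp Require Import all_boot all_order all_algebra.
From mathcomp Require Import reals.
From mathcomp Require Import zify ring lra.
Set Implicit Arguments.
Unset Strict Implicit.
Unset Printing Implicit Defensive.
Import Order.TTheory GRing.Theory Num.Theory IntDist.
Local Open Scope ring_scope.

(** For [eps = 0] and [sigma = 1] the coefficients [c], [c0] and [d] vanish
    and the remaining ones are [a = 2], [b = -1], [a0 = 39/16], [a1 = 31/16],
    [b0 = -13/16].  So, up to the factor [h^-1], the matrix is the tridiagonal
    second difference matrix, perturbed only in its first and last two rows;
    in particular it is a Z-matrix.

    A Z-matrix [A] is an M-matrix as soon as [A w > 0] for some vector [w > 0]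
    ([M_matrix_of_supersolution]).  This is a discrete maximum principle: if
    [A x >= 0], then at an index [i] minimizing [x i / w i] the sign pattern of
    [A] gives [(A x) i <= (x i / w i) * (A w) i], so the minimum cannot be
    negative.  Hence [A x >= 0] implies [x >= 0], which makes [A] injective and
    its inverse nonnegative.

    Here [w] is the discrete parabola [w j = j (N + 1 - j)], which is, up to
    scaling, the solution of [- u'' = 1] with homogeneous Dirichlet conditions:
    minus its second difference is [2] in each row, and in the boundary rows the
    perturbation only adds a positive amount ([ccg_row_parabola_gt0]). *)

Section Supersolution.
Variables (R : realType) (n : nat) (A : 'M[R]_n) (w : 'I_n -> R).
Hypotheses (AZ : Z_matrix A) (w_gt0 : forall i, 0 < w i).
Hypothesis Aw_gt0 : forall i, 0 < \sum_j A i j * w j.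

(** The discrete maximum principle: the quotient [x / w] is compared with its
    minimum [t]; since [x - t w] is nonnegative and vanishes at the minimizer,
    only off-diagonal entries of [A] contribute to [A (x - t w)] there. *)
Lemma Z_matrix_monotone (x : 'cV[R]_n) :
  (forall i, 0 <= (A *m x) i ord0) -> forall i, 0 <= x i ord0.
Proof.
move=> Ax_ge0 k; pose q i := x i ord0 / w i.
have xE i : x i ord0 = q i * w i by rewrite /q divfK ?gt_eqF.
case: (@arg_minP _ R _ k xpredT q isT) => i _ q_min.
have {}q_min j : q i <= q j by exact: q_min.
suff qi_ge0 : 0 <= q i 
  by rewrite xE (mulr_ge0 (le_trans qi_ge0 (q_min k))) // ltW.
rewrite -(pmulr_lge0 _ (Aw_gt0 i)); apply: le_trans (Ax_ge0 i) _.
rewrite mxE mulr_sumr; apply: ler_sum => j _.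
rewrite xE mulrCA; have [<-//|ij] := eqVneq i j.
rewrite ler_wnM2r ?q_min //.
by rewrite mulr_le0_ge0 ?AZ // ltW.
Qed.

Lemma Z_matrix_unitmx : A \in unitmx.
Proof.
(* [unitmx_tr] turns the criterion on row kernels into one on columns. *)
rewrite -unitmx_tr -row_free_unit -kermx_eq0; apply/eqP/row_matrixP => k.
set u := row k _; rewrite row0.
have Au0 : A *m u^T = 0.
  by apply: trmx_inj; rewrite trmx_mul trmxK -row_mul mulmx_ker row0 trmx0.
apply/rowP => i; rewrite [RHS]mxE; apply/eqP; rewrite eq_le; apply/andP; split.
  have /(_ i) : forall i, 0 <= (- u^T) i ord0.
    by apply: Z_matrix_monotone => j; rewrite mulmxN Au0 oppr0 mxE.
  by rewrite !mxE oppr_ge0.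
have /(_ i) : forall i, 0 <= u^T i ord0.
  by apply: Z_matrix_monotone => j; rewrite Au0 mxE.
by rewrite mxE.
Qed.

Lemma M_matrix_of_supersolution : M_matrix A.
Proof.
split=> [//||i j]; first exact: Z_matrix_unitmx.
have /(_ i) : forall i, 0 <= (col j (invmx A)) i ord0.
  apply: Z_matrix_monotone => k.
  by rewrite colE mulKVmx ?Z_matrix_unitmx // mxE ler0n.
by rewrite mxE.
Qed.

End Supersolution.

Section Entries.
Variables (R : realType) (N : nat).
Hypothesis N_ge7 : (7 <= N)%N.
Local Notation e := (@ccg_entry R 0 1 N).

Lemma ccg_entry_diag i :
  e i i = if (i == 1%N) || (i == N) then 39 / 16
          else if (i == 2%N) || (i == N.-1) then 31 / 16 else 2.
Proof.
rewrite /ccg_entry distnn /ccg_a0 /ccg_a1 /ccg_a.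
by case: ifP => _; [field | case: ifP => _; field].
Qed.

Lemma ccg_entry_sym i j : e i j = e j i.
Proof.
have sp k l : same_pair i j k l = same_pair j i k l.
  by rewrite /same_pair orbC andbC [X in _ || X]andbC.
rewrite /ccg_entry distnC !sp; case ji: `|j - i|%N => [|m] //.
by have -> : i = j by lia.
Qed.

Lemma ccg_entry_super i :
  e i i.+1 = if (i == 1%N) || (i.+1 == N) then - (13 / 16) else -1.
Proof.
rewrite /ccg_entry distnS /ccg_b0 /ccg_b.
have -> : same_pair i i.+1 1 2 || same_pair i i.+1 N.-1 N
          = (i == 1%N) || (i.+1 == N) by rewrite /same_pair; lia.
by case: ifP => _; field.
Qed.

Lemma ccg_entry_far (i j : nat) : (2 <= `|i - j|)%N -> e i j = 0.
Proof.
rewrite /ccg_entry /ccg_c0 /ccg_c /ccg_d.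
case: `|i - j|%N => [|[|[|[|k]]]] // _; last by field.
by case: ifP => _; field.
Qed.

Lemma ccg_entry_offdiag_le0 i j : i != j -> e i j <= 0.
Proof.
wlog ij : i j / (i < j)%N.
  move=> H; case: (ltngtP i j) => // ij _; first by apply: H; rewrite ?ltn_eqF.
  by rewrite ccg_entry_sym; apply: H; rewrite ?ltn_eqF.
move=> _; have [->|ji] := eqVneq j i.+1.
  by rewrite ccg_entry_super; case: ifP => _; lra.
by rewrite ccg_entry_far //; lia.
Qed.

(** Taken on all of [nat], so that its zeros [0] and [N.+1] can serve as
    boundary values next to the first and last row. *)
Definition parabola (j : nat) : R := j%:R * (N.+1%:R - j%:R).

Lemma parabola_gt0 j : (0 < j <= N)%N -> 0 < parabola j.
Proof.
by case/andP=> j0 jN; rewrite mulr_gt0 ?ltr0n // subr_gt0 ltr_nat ltnS.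
Qed.

Lemma ccg_row_parabola k : (k < N)%N ->
  \sum_(j < N) e k.+1 j.+1 * parabola j.+1 =
  e k.+1 k * parabola k + e k.+1 k.+1 * parabola k.+1
  + e k.+1 k.+2 * parabola k.+2.
Proof.
move=> kN; pose F j := e k.+1 j * parabola j.
have F0 : F 0 = 0 by rewrite /F /parabola mul0r mulr0.
have FN : F N.+1 = 0 by rewrite /F /parabola subrr !mulr0.
have Ffar (j : nat) : (2 <= `|k.+1 - j|)%N -> F j = 0.
  by move=> kj; rewrite /F ccg_entry_far ?mul0r.
(* Adding the two vanishing boundary terms makes every row, including the
   first and the last, have both of its neighbours in the range of the sum. *)
transitivity (\sum_(0 <= j < N.+2) F j).
  rewrite big_nat_recl // big_nat_recr //= F0 FN add0r addr0 big_mkord.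
  exact: eq_bigr.
rewrite (big_cat_nat (n := k)) //=; last lia.
rewrite [X in _ + X](big_cat_nat (n := k.+3)) //=; last lia.
rewrite [X in X + _]big_nat_cond [X in X + _]big1 ?add0r; last first.
  by move=> j /andP[/andP[_ jk] _]; apply: Ffar; lia.
rewrite [X in _ + X]big_nat_cond [X in _ + X]big1 ?addr0; last first.
  by move=> j /andP[/andP[jk _] _]; apply: Ffar; lia.
rewrite 3?big_ltn ?big_geq ?addr0 ?addrA //; lia.
Qed.

(** The row is worth [2] in the interior, [2 + (N + 2) / 16] in the second row
    and [2 + (7 w 1 + 3 w 2) / 16] in the first, where [w] is the parabola, and
    likewise at the other end. *)
Lemma ccg_row_parabola_gt0 k : (k < N)%N ->
  0 < \sum_(j < N) e k.+1 j.+1 * parabola j.+1.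
Proof.
move=> kN; rewrite ccg_row_parabola // (ccg_entry_sym _ k).
rewrite ccg_entry_diag !ccg_entry_super /parabola.
have N_gt0 : (0 : R) < N%:R by rewrite ltr0n; lia.
have [k_le1|k_ge2] := leqP k 1.
  case: k kN k_le1 => [|[|k]] // kN _ /=; first lra.
  have [-> ->] : (2 == N) = false /\ (3 == N) = false by lia.
  lra.
have [-> [-> ->]] : (k == 1%N) = false /\ (k.+1 == 1%N) = false
                    /\ (k.+1 == 2%N) = false by lia.
have [kN1|_] := eqVneq k.+1 N; first by rewrite -kN1 /= in N_gt0 *; lra.
have [kN2|kN2] := eqVneq k.+2 N; first by rewrite -kN2 eqxx /= in N_gt0 *; lra.
have -> : (k.+1 == N.-1) = false by lia.
rewrite /=; lra.
Qed.

End Entries.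

Theorem theorem9p4 (R : realType) (N : nat) (h eps sigma : R)
  (hN : (7 <= N)%N) (hh : 0 < h) (heps : eps = 0) (hsigma : sigma = 1) :
  M_matrix (ccg_T eps sigma N h).
Proof.
rewrite heps hsigma.
apply: (M_matrix_of_supersolution (w := fun i => parabola R N i.+1)).
- move=> i j ij; rewrite !mxE pmulr_rle0 ?invr_gt0 //.
  exact: ccg_entry_offdiag_le0.
- by move=> i; rewrite parabola_gt0 /=.
- move=> i; under eq_bigr do rewrite !mxE -mulrA.
  by rewrite -mulr_sumr mulr_gt0 ?invr_gt0 // ccg_row_parabola_gt0.
Qed.
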